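(* Consider the Markov decision process described in the context: state space $\mathcal{X}_K$, action spaces $A(\mathbf{x})=\{\mathbf{y}\in\mathcal{X}_K:\mathbf{y}\subset\mathbf{x}\}$ for $\mathbf{x}\in\mathcal{X}_K$, reward function $r(\mathbf{x},\mathbf{a})=R\sum_{(x,m)\in\mathbf{x}\setminus\mathbf{a}}m$ with $R>0$, and birth-death-growth dynamics based on independent deaths with probability $p_d\in(0,1)$, a hard core birth process with intensity $\beta>0$ marked independently according to a probability measure $\nu$ on $[0,K]$, $K>0$, and growth function $g$. Write $g^{(n)}(m)$ for the $n$-fold composition of $g$. Let $\alpha\in[0,1)$, set $v_0(\mathbf{x})=0$ for all $\mathbf{x}\in\mathcal{X}_K$ and define, for $n\in\mathbb{N}$ and $\mathbf{x}\in\mathcal{X}_K$, $$ v_n(\mathbf{x}) = \max_{\mathbf{a}\subset\mathbf{x}}\left\{ R\sum_{(x,m)\in\mathbf{x}\setminus\mathbf{a}} m + \alpha\,\mathbb{E}\left[v_{n-1}(X)\mid\mathbf{x},\mathbf{a}\right]\right\}. $$ Then, for all $n\in\mathbb{N}_0$ and all $\mathbf{x}\in\mathcal{X}_K$, $\tilde v_n(\mathbf{x})\le v_n(\mathbf{x})\le\hat v_n(\mathbf{x})$, where $$ \tilde v_n(\mathbf{x}) = R\sum_{(x,m)\in\mathbf{x}}\tilde s_n(x,m) + R\beta\sum_{k=1}^{n-1}\alpha^k\int_W\int_0^K \tilde s_{n-k}(w,l)\,d\nu(l)\,dw, $$ $$ \hat v_n(\mathbf{x}) = R\sum_{(x,m)\in\mathbf{x}}\hat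 s_n(m) + R\beta|W|\sum_{k=1}^{n-1}\alpha^k\int_0^K\hat s_{n-k}(l)\,d\nu(l), $$ with $\tilde s_0=\hat s_0=0$ and, for $n\in\mathbb{N}$, $$ \hat s_n(m) = \max\left\{ m,\ \alpha(1-p_d)g^{(1)}(m),\ \dots,\ \alpha^{n-1}(1-p_d)^{n-1}g^{(n-1)}(m)\right\} $$ and, writing $b(x,K)$ for the closed ball centred at $x$ with radius $K$, $$ \tilde s_n(x,m) = \max_{j=0,\dots,n-1}\left\{ \alpha^j(1-p_d)^j g^{(j)}(m) - \alpha K\beta\,|b(x,K)\cap W|\sum_{i=0}^{j-1}\alpha^i(1-p_d)^i\right\}. $$
   Context: Notation: $\mathbb{N}=\{1,2,\dots\}$, $\mathbb{N}_0=\mathbb{N}\cup\{0\}$; $0^0=1$; $g^{(0)}(m)=m$; empty sums are $0$; $|\cdot|$ denotes area. $W\subset\mathbb{R}^2$ is compact and $K>0$. The state space $\mathcal{X}_K$ is the set of all finite simple marked point patterns $\mathbf{x}$ (finite sets of pairs $(x,m)$ with distinct locations $x\in W$ and marks $m\in[0,K]$) that contain no pair of points with locations $x_1\neq x_2$ such that $\|x_1-x_2\|\le K$. In state $\mathbf{x}$ an action is a subset $\mathbf{a}\subset\mathbf{x}$ of retained points; all subsets are allowed. Dynamics: when action $\mathbf{a}$ is taken in state $\mathbf{x}\in\mathcal{X}_K$, the next state $X$ is obtained as follows. (1) Delete $\mathbf{x}\setminus\mathbf{a}$. (2) Independently of other points, each $(x,m)\in\mathbf{a}$ dies (is removed) with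 probability $p_d\in(0,1)$ and otherwise becomes $(x,g(m))$, where $g:[0,K]\to[0,K]$ is a bounded, continuous function with $m\le g(m)$ for all $m\in[0,K]$. (3) Add a hard core point process on $W$ with hard core distance $K$ (almost surely no two of its points are at distance $\le K$) and constant intensity $\beta>0$ (the expected number of points in a Borel set $B\subset W$ is $\beta|B|$); mark its points independently according to a probability measure $\nu$ on $[0,K]$, and remove all of these new points that fall within distance $K$ of (the location of) a point in $\mathbf{a}$. $\mathbb{E}[\,\cdot\mid\mathbf{x},\mathbf{a}]$ denotes expectation with respect to this one-step law of the next state $X$. *)

(* Defs.v *)
From HB Require Import structures.
From mathcomp Require Import all_boot all_order all_algebra finmap.
From mathcomp Require Import all_classical all_reals all_analysis.

Set Implicit Arguments.
Unset Strict Implicit.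
Unset Printing Implicit Defensive.

Import Order.TTheory GRing.Theory Num.Theory.
Import numFieldNormedType.Exports.

Local Open Scope classical_set_scope.
Local Open Scope fset_scope.
Local Open Scope ring_scope.

Section Geometry.
Context {R : realType}.

(* The library norm on R * R is the sup norm, hence this definition. *)
Definition eucl_dist (y z : R * R) : R :=
  Num.sqrt ((y.1 - z.1) ^+ 2 + (y.2 - z.2) ^+ 2).

Definition cball (y : R * R) (r : R) : set (R * R) :=
  [set z | eucl_dist y z <= r].

Definition area : set (measurableTypeR R * measurableTypeR R) -> \bar R :=
  (@lebesgue_measure R \x @lebesgue_measure R)%E.

End Geometry.

Section Process.
Context {R : realType} (W : set (R * R)) (K : R).

(* A marked point is a pair (location, mark). *)
Definition state_space : set {fset (R * R) * R} :=
  [set x | [/\ forall p, p \in x -> W p.1 /\ 0 <= p.2 <= K,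
               forall p q, p \in x -> q \in x -> p != q -> p.1 != q.1 &
               forall p q, p \in x -> q \in x -> p.1 != q.1 ->
                 ~~ (eucl_dist p.1 q.1 <= K)]].

Definition actions (x : {fset (R * R) * R}) : {fset {fset (R * R) * R}} :=
  [fset a in fpowerset x | `[< state_space a >]].

Definition npoints (B : set (R * R)) (phi : {fset R * R}) : nat :=
  #|` [fset y in phi | `[< B y >]]|.

(* Phi is a finite simple point process on W, measurable with respect to the
   sigma-algebra generated by the counts in Borel sets. *)
Definition hard_core_process (beta : R) d (Omega : measurableType d)
    (P : probability Omega R) (Phi : Omega -> {fset R * R}) : Prop :=
  [/\ forall w y, y \in Phi w -> W y,
      forall B : set (measurableTypeR R * measurableTypeR R), measurable B ->
        measurable_fun setT (fun w => (npoints B (Phi w))%:R : R),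
      {ae P, forall w, forall y z, y \in Phi w -> z \in Phi w -> y != z ->
        ~~ (eucl_dist y z <= K)} &
      forall B : set (measurableTypeR R * measurableTypeR R), measurable B ->
        (B `<=` W)%classic ->
        ('E_P[fun w => (npoints B (Phi w))%:R] = beta%:E * area B)%E].

End Process.

Section Dynamics.
Context {R : realType} d {Omega : measurableType d} (P : probability Omega R).
Context (W : set (R * R)) (K Rw pd alpha : R) (g : R -> R).
Context (nu : probability (measurableTypeR R) R) (Phi : Omega -> {fset R * R}).

Local Open Scope ereal_scope.

(* Expectation of F when the locations ys receive independent marks of law nu
   on [0, K], i.e., the integral of F over the product of size ys copies of nu.
   Since F below only depends on the set of marked points, the order in which
   a finite set of locations is enumerated is irrelevant. *)
Fixpoint mark_mean (ys : seq (R * R)) (F : seq ((R * R) * R) -> \bar R)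
    : \bar R :=
  if ys is y :: ys' then
    \int[nu]_(l in `[0%R, K]) mark_mean ys' (fun ps => F ((y, l) :: ps))
  else F [::].

Definition grow (s : {fset (R * R) * R}) : {fset (R * R) * R} :=
  [fset (p.1, g p.2) | p in s].

Definition admit_births (a : {fset (R * R) * R}) (ps : seq ((R * R) * R))
    : {fset (R * R) * R} :=
  [fset p in ps | all (fun q => ~~ (eucl_dist q.1 p.1 <= K)%R) (enum_fset a)].

(* E[F(X) | x, a]; the law of X depends on (x, a) through a only.  The set s
   of survivors of a is selected by independent deaths, independently of the
   marked births. *)
Definition next_mean (F : {fset (R * R) * R} -> \bar R)
    (a : {fset (R * R) * R}) : \bar R :=
  \sum_(s <- fpowerset a)
    ((1 - pd) ^+ #|` s| * pd ^+ #|` a `\` s|)%:E *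
    \int[P]_w mark_mean (enum_fset (Phi w))
      (fun ps => F (grow s `|` admit_births a ps)).

Definition reward (x a : {fset (R * R) * R}) : R :=
  (Rw * \sum_(p <- x `\` a) p.2)%R.

Fixpoint value (n : nat) (x : {fset (R * R) * R}) : \bar R :=
  if n is n'.+1 then
    \big[maxe/-oo]_(a <- actions W K x)
      ((reward x a)%:E + alpha%:E * next_mean (value n') a)
  else 0.

End Dynamics.

Section Bounds.
Context {R : realType} (W : set (R * R)) (K Rw pd beta alpha : R) (g : R -> R).
Context (nu : probability (measurableTypeR R) R).

Local Open Scope ring_scope.

(* In both maxima the default value m is the term of index 0. *)
Definition shat (n : nat) (m : R) : R :=
  if n is _.+1 then
    \big[Num.max/m]_(j < n) (alpha ^+ j * (1 - pd) ^+ j * iter j g m)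
  else 0.

Definition stilde (n : nat) (y : R * R) (m : R) : R :=
  if n is _.+1 then
    \big[Num.max/m]_(j < n)
      (alpha ^+ j * (1 - pd) ^+ j * iter j g m
       - alpha * K * beta * fine (area (cball y K `&` W)%classic) *
         \sum_(i < j) (alpha ^+ i * (1 - pd) ^+ i))
  else 0.

Local Open Scope ereal_scope.

Definition vhat (n : nat) (x : {fset (R * R) * R}) : \bar R :=
  (Rw * \sum_(p <- x) shat n p.2)%:E +
  (Rw * beta)%:E * area W *
    \sum_(1 <= k < n) (alpha ^+ k)%:E *
      \int[nu]_(l in `[0%R, K]) (shat (n - k) l)%:E.

Definition vtilde (n : nat) (x : {fset (R * R) * R}) : \bar R :=
  (Rw * \sum_(p <- x) stilde n p.1 p.2)%:E +
  (Rw * beta)%:E *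
    \sum_(1 <= k < n) (alpha ^+ k)%:E *
      \int[@lebesgue_measure R \x @lebesgue_measure R]_(w in W)
        \int[nu]_(l in `[0%R, K]) (stilde (n - k) w l)%:E.

End Bounds.

(* Main.v *)
Require Import Defs.
From mathcomp Require Import all_boot all_order all_algebra finmap.
From mathcomp Require Import all_classical all_reals all_analysis.
From mathcomp Require Import measurable_realfun lra.

(* Integrals of nonnegative functions that are not known to be measurable are
   lower integrals, i.e., suprema over the nonnegative simple functions below
   the integrand.  They are monotone without any measurability assumption, so
   the measurability of the value functions is never needed.

   Both bounds are proved by induction on n.  Writing c = alpha (1 - pd), the
   one-point scores satisfy
     shat_{n+1}(m) = max(m, c shat_n(g m)),
     stilde_{n+1}(y, m) = max(m, c stilde_n(y, g m) - alpha K beta |b(y,K) & W|),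
   and by Campbell's formula the births contribute to the expectation of an
   additive functional at most its integral over W against the birth intensity,
   and at least this integral minus what is lost in the balls of radius K around
   the retained points, where scores are at most K.  For the upper bound each
   action is compared with the two branches of the first maximum; for the lower
   bound the action retains the points where the second branch of the second
   maximum exceeds the mark. *)

Set Implicit Arguments.
Unset Strict Implicit.
Unset Printing Implicit Defensive.

Import Order.TTheory GRing.Theory Num.Theory.
Import numFieldNormedType.Exports.

Local Open Scope classical_set_scope.
Local Open Scope fset_scope.
Local Open Scope ring_scope.

(** * Integrals of nonnegative functions of unknown measurability *)

Section lower_integral.
Context d (T : measurableType d) (R : realType) (mu : {measure set T -> \bar R}).
Local Open Scope ereal_scope.
Import HBNNSimple.

Lemma ge0_le_integral_nonmeas (D : set T) (f g : T -> \bar R) :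
  (forall x, D x -> 0 <= f x) -> (forall x, D x -> f x <= g x) ->
  \int[mu]_(x in D) f x <= \int[mu]_(x in D) g x.
Proof.
move=> f0 fg; have g0 x : D x -> 0 <= g x.
  by move=> Dx; exact: le_trans (f0 _ Dx) (fg _ Dx).
rewrite !ge0_integralE//; apply: ereal_sup_le => _ [h hf <-].
by exists h => // x; apply: le_trans (hf x) _; exact: lee_restrict.
Qed.

(** This reduces a bound on the integral of an arbitrary nonnegative function to simple functions,
    for which Campbell's formula is exact. *)
Lemma le_ge0_integral_sup (D : set T) (f : T -> \bar R) (M : \bar R) :
  (forall x, D x -> 0 <= f x) ->
  (forall h : {nnsfun T >-> R}, (forall x, (h x)%:E <= (f \_ D) x) ->
     sintegral mu h <= M) ->
  \int[mu]_(x in D) f x <= M.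
Proof.
move=> f0 hM; rewrite ge0_integralE//; apply: ge_ereal_sup => _ [h hf <-].
exact: hM.
Qed.

(** Lower integrals need not be additive, and [g] may be non-measurable. The positive part [w] of
    [f - u] is measurable, lies below [g] off [N], and satisfies [f <= w + u], so additivity is
    applied to [w + u] only. *)
Lemma ge0_integral_le_add (N : set T) (f u : T -> R) (g : T -> \bar R) :
  measurable N -> mu N = 0 ->
  measurable_fun setT f -> measurable_fun setT u ->
  (forall x, 0 <= f x)%R -> (forall x, 0 <= u x)%R -> (forall x, 0 <= g x) ->
  (forall x, ~ N x -> (f x)%:E <= g x + (u x)%:E) ->
  \int[mu]_x (f x)%:E <= \int[mu]_x g x + \int[mu]_x (u x)%:E.
Proof.
move=> mN N0 mf mu' f0 u0 g0 fgu.
pose w x : R := Num.max (f x - u x)%R 0%R.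
have mw : measurable_fun setT w.
  by apply: measurable_maxr => //; exact: measurable_funB.
have w0 x : (0 <= w x)%R by rewrite le_max lexx orbT.
have mNC : measurable (~` N) by exact: measurableC.
rewrite (ge0_negligible_integral mN) ?setTD//; last 2 first.
- exact/measurable_EFinP.
- by move=> x _; rewrite lee_fin.
apply: (@le_trans _ _ (\int[mu]_(x in ~` N) ((w x)%:E + (u x)%:E))).
  apply: ge0_le_integral_nonmeas => x _; first by rewrite lee_fin.
  by rewrite -EFinD lee_fin -lerBlDr le_max lexx.
rewrite ge0_integralD//; last 4 first.
- by move=> x _; rewrite lee_fin.
- by apply/measurable_EFinP; exact: measurable_funTS.
- by move=> x _; rewrite lee_fin.
- by apply/measurable_EFinP; exact: measurable_funTS.
apply: leeD; rewrite integral_mkcond; apply: ge0_le_integral_nonmeas => x _.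
- by rewrite erestrict_ge0// => y _; rewrite lee_fin.
- rewrite patchE; case: ifPn => //; rewrite inE => xN.
  rewrite /w EFin_max ge_max g0 andbT.
  by rewrite EFinB leeBlDr// fgu.
- by rewrite erestrict_ge0// => y _; rewrite lee_fin.
- by rewrite patchE; case: ifPn => // _; rewrite lee_fin.
Qed.

End lower_integral.

(** * Open, compact and ball subsets of the plane in the product sigma-algebra *)

Section planar_borel.
Context {R : realType}.
Local Notation R2 := (measurableTypeR R * measurableTypeR R)%type.

Lemma prod_open_measurable (U : set (R * R)) : open U ->
  measurable (U : set R2).
Proof.
move=> oU.
(* Squares with rational centre and half-width 1/(n+1) form a countable base, so [U] is the union of
   those contained in it. *)
pose F (q : (rat * rat) * nat) : set R2 :=
  [set z | ball (ratr q.1.1 : R) q.2.+1%:R^-1 z.1 /\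
           ball (ratr q.1.2 : R) q.2.+1%:R^-1 z.2].
have mF q : measurable (F q).
  have -> : F q = (ball (ratr q.1.1 : R) q.2.+1%:R^-1 `*`
                   ball (ratr q.1.2 : R) q.2.+1%:R^-1)%classic by [].
  by apply: measurableX; exact: measurable_ball.
suff -> : U = \bigcup_q (if `[< (F q `<=` U)%classic >] then F q else set0).
  by apply: countable_bigcupT_measurable => // q; case: ifP.
apply/seteqP; split => [z Uz|z [q _]]; last first.
  by case: ifPn => // /asboolP; exact.
have /nbhs_ballP[e /= e0 zeU] : nbhs z U by exact: open_nbhs_nbhs.
(* Half of [e] suffices: the rational centre is within 1/(n+1) of [z], and the points of the square
   are within 1/(n+1) of that centre. *)
have [n en] : exists n : nat, (n.+1%:R^-1 < e / 2 :> R)%R.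
  have e2 : 0 < e / 2 by rewrite divr_gt0.
  have [n _ /(_ n (leqnn n)) nP] := near_infty_natSinv_lt (PosNum e2).
  by exists n.
have near_rat (t : R) : exists q : rat, `|ratr q - t| < n.+1%:R^-1.
  have : t - n.+1%:R^-1 < t + n.+1%:R^-1.
    by rewrite ltrD2l (@lt_trans _ _ 0)// ?oppr_lt0 invr_gt0.
  move=> /rat_in_itvoo[q]; rewrite in_itv /= => /andP[q1 q2]; exists q.
  by rewrite ltr_norml ltrBlDr ltrBrDr (addrC _ t) q1 addrC.
have [q1 hq1] := near_rat z.1; have [q2 hq2] := near_rat z.2.
have ball_q (q : rat) (t y : R) : `|ratr q - t| < n.+1%:R^-1 ->
    ball (ratr q : R) n.+1%:R^-1 y -> ball t e y.
  move=> qt qy; apply: (@ball_split R R (ratr q : R)); last exact: le_ball (ltW en) _ qy.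
  by apply: le_ball (ltW en) _ _; rewrite -ball_normE /ball_ /= distrC.
exists (q1, q2, n) => //; rewrite ifT; first by split; rewrite -ball_normE.
by apply/asboolP => y [/= y1 y2]; apply: zeU; split; 
  [exact: ball_q hq1 y1|exact: ball_q hq2 y2].
Qed.

Lemma prod_hausdorff : hausdorff_space (R * R)%type.
Proof. exact: norm_hausdorff. Qed.

Lemma prod_compact_measurable (W : set (R * R)) : compact W ->
  measurable (W : set R2).
Proof.
move=> cW; rewrite -(setCK (W : set R2)); apply: measurableC.
by apply: prod_open_measurable; exact: closed_openC (compact_closed prod_hausdorff cW).
Qed.

Lemma prod_compact_area_fin (W : set (R * R)) : compact W -> 
  (area W < +oo)%E.
Proof.
move=> cW; have mW := prod_compact_measurable cW.
have [M [_ hM]] := @compact_bounded R (R * R)%type W cW.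
pose I : set (measurableTypeR R) := `[- (`|M| + 1), `|M| + 1]%classic.
have mI : measurable I by exact: measurable_itv.
have WI : (W `<=` I `*` I)%classic.
  move=> z Wz; have : `|z| <= `|M| + 1.
    by apply: (hM (`|M| + 1)) => //; rewrite ltr_pwDr// ler_norm.
  rewrite /Num.norm /= ge_max => /andP[z1 z2].
  by split; rewrite /I /= in_itv /= -ler_norml.
apply: (@le_lt_trans _ _ (area (I `*` I)%classic)).
  by apply: le_measure; rewrite ?inE//; exact: measurableX.
have Ifin : (@lebesgue_measure R I < +oo)%E.
  by rewrite /I lebesgue_measure_itv/= lte_fin; case: ifP => // _; rewrite -EFinB ltry.
rewrite /area product_measure1E//; apply: lte_mul_pinfty => //.
by rewrite ge0_fin_numE.
Qed.

Lemma cball_measurable (y : R * R) (r : R) : measurable (cball y r : set R2).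
Proof.
have -> : cball y r = ([set: R2] `&` (fun z : R2 => eucl_dist y z) @^-1` `]-oo, r]%classic)%classic.
  by rewrite setTI; apply/seteqP; split => z; rewrite /= in_itv.
suff mf : measurable_fun [set: R2] (fun z : R2 => eucl_dist y z).
  by apply: mf => //; exact: measurable_itv.
apply: (measurableT_comp (continuous_measurable_fun (@sqrt_continuous R))).
apply: measurable_funD; apply: measurable_funX; apply: measurable_funB => //.
Qed.

End planar_borel.

(** * Campbell's formula for the birth process *)

Section campbell.
Context {R : realType} d (Omega : measurableType d) (P : probability Omega R).
Context (W : set (R * R)) (K beta : R) (Phi : Omega -> {fset R * R}).
Hypothesis birth : hard_core_process W K beta P Phi.
Local Notation R2 := (measurableTypeR R * measurableTypeR R)%type.
Local Open Scope ereal_scope.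
Import HBNNSimple.

Lemma npointsE (B : set (R * R)) (phi : {fset R * R}) :
  (npoints B phi)%:R = (\sum_(y <- phi) \1_B y)%R :> R.
Proof.
rewrite /npoints card_fset_sum1 natr_sum big_fset /= big_mkcond /=.
apply: eq_bigr => y _; rewrite indicE.
by rewrite (_ : y \in B = `[< B y >])//; case: ifP.
Qed.

Lemma npoints_measurable (B : set R2) : measurable B ->
  measurable_fun setT (fun w => (npoints B (Phi w))%:R : R).
Proof. by case: birth => _ + _ _; exact. Qed.

Lemma npoints_mean (B : set R2) : measurable B -> (B `<=` W)%classic ->
  \int[P]_w ((npoints B (Phi w))%:R)%:E = beta%:E * area B.
Proof. by case: birth => _ _ _ + mB BW => /(_ B mB BW); rewrite unlock. Qed.

(** Grouping the points by the level sets of [f] leaves only counts, whose measurability and means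
    are what the point process provides. *)
Lemma sum_nnsfun_npoints (f : {nnsfun R2 >-> R}) (phi : {fset R * R}) :
  (\sum_(y <- phi) f y =
   \sum_(r <- fset_set (range f)) r * (npoints (f @^-1` [set r]) phi)%:R)%R.
Proof.
under [RHS]eq_bigr do rewrite npointsE mulr_sumr.
rewrite exchange_big /=; apply: eq_bigr => y _.
by rewrite [LHS](fimfunE f) fsbig_finite.
Qed.

Lemma sum_nnsfun_measurable (f : {nnsfun R2 >-> R}) :
  measurable_fun setT (fun w => (\sum_(y <- Phi w) f y)%R).
Proof.
under eq_fun do rewrite sum_nnsfun_npoints.
apply: measurable_sum => r; apply: measurable_funM => //.
exact: npoints_measurable.
Qed.

Lemma campbell_nnsfun (f : {nnsfun R2 >-> R}) :
  (forall y, ~ W y -> f y = 0%R) ->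
  \int[P]_w (\sum_(y <- Phi w) f y)%:E =
  beta%:E * sintegral (@lebesgue_measure R \x @lebesgue_measure R) f.
Proof.
move=> f0; under eq_integral do rewrite sum_nnsfun_npoints -sumEFin.
rewrite sintegralE fsbig_finite//.
have rn0 r w : (0 <= r * (npoints (f @^-1` [set r]) (Phi w))%:R)%R.
  have [r0|r0] := leP 0%R r; first by rewrite mulr_ge0.
  rewrite preimage_nnfun0// npointsE big1 ?mulr0// => y _.
  by rewrite indic0.
rewrite ge0_integral_sum//; last 2 first.
- move=> r; apply/measurable_EFinP; apply: measurable_funM => //.
  exact: npoints_measurable.
- by move=> r w _; rewrite lee_fin.
rewrite ge0_sume_distrr; last by move=> r _; exact: nnsfun_mulemu_ge0.
apply: eq_bigr => r _.
(* The intensity is prescribed only inside [W]. The level set of 0 may leave [W] but contributes 0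
   on both sides, those of negative values are empty, and those of positive values lie in [W]. *)
have [->|r0] := eqVneq r 0%R.
  by rewrite mul0e mule0 integral0_eq// => w _; rewrite mul0r.
have [r_lt0|r_ge0] := ltP r 0%R.
  rewrite preimage_nnfun0// measure0 !mule0 integral0_eq// => w _.
  by rewrite npointsE big1 ?mulr0// => y _; rewrite indic0.
under eq_integral do rewrite EFinM.
rewrite ge0_integralZl_EFin//; last exact/measurable_EFinP/npoints_measurable.
have fW : (f @^-1` [set r] `<=` W)%classic.
  by move=> y fy; apply: contrapT => /f0; rewrite fy => /eqP; exact/negP.
by rewrite (npoints_mean _ fW)// muleCA.
Qed.

(** Here [U] is an allowance for the score lost pathwise. Since [h] and [F] are not assumed
    measurable, the integral of [h] is approached from below by simple functions, and Campbell's
    formula is used for each of them. *)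
Lemma campbell_ge (c r : R) (h : R * R -> \bar R) (U : Omega -> R)
    (F : Omega -> \bar R) :
  (0 < beta)%R -> (0 <= c)%R -> (0 < r)%R -> (forall y, W y -> 0 <= h y) ->
  (forall w, 0 <= F w) ->
  measurable_fun setT U -> (forall w, (0 <= U w)%R) ->
  (forall w, {in Phi w &, forall y z, y != z -> ~~ (eucl_dist y z <= K)%R} ->
     c%:E + r%:E * \sum_(y <- Phi w) h y <= F w + (U w)%:E) ->
  c%:E + (r * beta)%:E *
    \int[@lebesgue_measure R \x @lebesgue_measure R]_(y in W) h y
  <= \int[P]_w F w + \int[P]_w (U w)%:E.
Proof.
move=> beta0 c0 r0 h0 F0 mU U0 hF.
have [PhiW _ [N [mN PN subN]] _] := birth.
set X := _ + \int[P]_w (U w)%:E.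
(* The integral of [h] is isolated on the left, so that a bound for every simple function below [h]
   is enough. *)
rewrite addeC -leeBrDr// muleC -lee_pdivlMr ?mulr_gt0//.
apply: le_ge0_integral_sup => // f fh.
have f0 y : ~ W y -> f y = 0%R.
  move=> Wy; apply/eqP; rewrite eq_le fun_ge0 andbT -lee_fin.
  by apply: le_trans (fh y) _; rewrite patchE memNset.
rewrite lee_pdivlMr ?mulr_gt0// leeBrDr// muleC EFinM -muleA -campbell_nnsfun//.
have S0 w : (0 <= \sum_(y <- Phi w) f y)%R by exact: sumr_ge0.
have mS := sum_nnsfun_measurable f.
have <- : \int[P]_w (c + r * \sum_(y <- Phi w) f y)%:E =
    r%:E * \int[P]_w (\sum_(y <- Phi w) f y)%:E + c%:E.
  under eq_integral do rewrite EFinD EFinM.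
  rewrite ge0_integralD//.
  - rewrite integral_cst// [X in c%:E * X](probability_setT P) mule1 addeC ge0_integralZl_EFin//.
    + by move=> w _; rewrite lee_fin.
    + exact/measurable_EFinP.
    + exact: ltW.
  - by move=> w _; apply: mule_ge0; rewrite lee_fin// ltW.
  - by apply/measurable_EFinP; exact: measurable_funM.
apply: (ge0_integral_le_add mN PN) => //.
- by apply: measurable_funD => //; exact: measurable_funM.
- by move=> w; apply: addr_ge0 => //; apply: mulr_ge0 => //; exact: ltW.
(* The null set [N] contains every outcome that violates the hard core condition. *)
move=> w Nw; have hw : {in Phi w &, forall y z, y != z -> ~~ (eucl_dist y z <= K)%R}.
  move=> y z yw zw yz; apply: contrapT => yzK.
  by apply: Nw; apply: subN => /= /(_ y z yw zw yz).
apply: le_trans (hF w hw); rewrite EFinD EFinM leeD2l// lee_pmul2l//.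
rewrite -sumEFin big_seq [leRHS]big_seq; apply: lee_sum => y yw.
by apply: le_trans (fh y) _; rewrite patchE mem_set//; exact: PhiW yw.
Qed.

End campbell.

(** * Independent deaths as a sum over surviving subsets *)

Section thinning.
Context {R : realType} {T : choiceType}.

Lemma le_sum_uniq_sub (s t : seq T) (f : T -> R) : uniq s -> {subset s <= t} ->
  (forall x, x \in t -> 0 <= f x) -> \sum_(x <- s) f x <= \sum_(x <- t) f x.
Proof.
elim: s t => [|x s IH] t /=.
  by move=> _ _ f0; rewrite big_nil big_seq sumr_ge0.
move=> /andP[xs us] st f0; have xt : x \in t by apply: st; rewrite mem_head.
rewrite big_cons (perm_big _ (perm_to_rem xt)) big_cons lerD2l; apply: IH => //.
  move=> y ys; have yt : y \in t by apply: st; rewrite inE ys orbT.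
  have := perm_mem (perm_to_rem xt) y; rewrite yt inE => /esym.
  by have [yx|//] := eqVneq y x; rewrite -yx ys in xs.
by move=> y /mem_rem; exact: f0.
Qed.

(** The subsets are split by whether they contain [q]; those that do correspond to subsets of [b] by
    removing [q]. *)
Lemma big_fpowersetU1 (q : T) (b : {fset T}) (G : {fset T} -> R) : q \notin b ->
  \sum_(s <- fpowerset (q |` b)) G s =
  \sum_(s <- fpowerset b) (G s + G (q |` s)).
Proof.
move=> qb; rewrite big_split [LHS](big_fsetID _ (fun s : {fset T} => q \notin s)) /=.
congr (_ + _).
  apply: eq_fbigl => s; rewrite !inE /= !fpowersetE.
  by rewrite -[in RHS](fsetU1K qb) fsubsetD1.
rewrite -[RHS](@big_imfset _ _ _ _ _ imfset_key (fun s => q |` s) (mem (fpowerset b)) G);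
  last first.
  move=> s t; rewrite !fpowersetE => sb tb st.
  by rewrite -(fsetU1K (contra (fsubsetP sb q) qb)) st (fsetU1K (contra (fsubsetP tb q) qb)).
apply: eq_fbigl => s; rewrite !inE /= !fpowersetE negbK.
apply/andP/imfsetP => /= [[sqb qs]|[t + ->]].
  exists (s `\ q); rewrite ?fsetD1K// fpowersetE -(fsetU1K qb).
  exact: fsetSD.
rewrite fpowersetE => tb; split; last by rewrite fset1U1.
exact: fsetUS.
Qed.

Lemma thinning_sum (a : {fset T}) (f : T -> R) (p C : R) :
  \sum_(s <- fpowerset a) (1 - p) ^+ #|` s| * p ^+ #|` a `\` s| *
     (\sum_(q <- s) f q + C) =
  (1 - p) * (\sum_(q <- a) f q) + C.
Proof.
elim/fset1U_rect: a C => [|q b qb IH] C.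
  rewrite fpowerset0 big_seq_fset1 fset0D cardfs0 big_seq_fset0.
  by rewrite !expr0 !mul1r mulr0.
rewrite big_fpowersetU1// big_fsetU1//=.
(* The survival of [q] adds [f q] with weight [1 - p]. This mean is absorbed into the constant,
   which is why the induction leaves [C] free. *)
transitivity ((1 - p) * (\sum_(q <- b) f q) + (C + (1 - p) * f q)).
  2: by lra.
rewrite -IH big_seq [RHS]big_seq; apply: eq_bigr => s; rewrite fpowersetE => sb.
have qs : q \notin s by apply: contra (fsubsetP sb q) qb.
rewrite big_fsetU1//= cardfsU1 qs add1n.
have -> : #|` (q |` b) `\` s| = (#|` b `\` s|).+1.
  rewrite fsetDUl (_ : [fset q] `\` s = [fset q]); last first.
    by apply/fsetP => x; rewrite !inE; have [->|] := eqVneq x q; rewrite ?qs ?andbF.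
  by rewrite cardfsU1 !inE (negbTE qb) andbF.
have -> : (q |` b) `\` (q |` s) = b `\` s.
  apply/fsetP => x; rewrite !inE negb_or.
  by have [->|] := eqVneq x q; rewrite ?(negbTE qb) ?andbF.
rewrite !exprS; set X := \sum_(_ <- _) _; set u := (1 - p) ^+ _; set v := p ^+ _.
lra.
Qed.

End thinning.

(** * Averaging over independent marks *)

Section marks.
Context {R : realType} (K : R) (nu : probability (measurableTypeR R) R).
Hypothesis nu_supp : nu `[0, K]%classic = 1%E.
Local Open Scope ereal_scope.
Implicit Types (ys : seq (R * R)) (F G : seq ((R * R) * R) -> \bar R).

(** Nonnegativity is carried along because comparing the outer integral needs the inner means to be
    nonnegative. Only lists over [ys] with marks in [0, K] matter, as each integral runs over that
    interval. *)
Lemma mark_mean_le ys F G :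
  (forall ps, [seq p.1 | p <- ps] = ys ->
     (forall p, p \in ps -> 0 <= p.2 <= K)%R -> 0 <= F ps <= G ps) ->
  0 <= mark_mean K nu ys F <= mark_mean K nu ys G.
Proof.
elim: ys F G => [|y ys IH] F G FG /=; first exact: FG.
have {}IH (l : R) : (0 <= l <= K)%R ->
    0 <= mark_mean K nu ys (fun ps => F ((y, l) :: ps)) <=
         mark_mean K nu ys (fun ps => G ((y, l) :: ps)).
  move=> l0K; apply: IH => ps psE ps0K; apply: FG => [|p]; first by rewrite /= psE.
  by rewrite inE => /predU1P[->|/ps0K].
apply/andP; split.
  by apply: integral_ge0 => l; rewrite /= in_itv/= => /IH/andP[].
by apply: ge0_le_integral_nonmeas => l; rewrite /= in_itv/= => /IH/andP[].
Qed.

Lemma integral_cst_marks (c : \bar R) : \int[nu]_(l in `[0%R, K]) c = c.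
Proof. by rewrite integral_cst// [X in c * X]nu_supp mule1. Qed.

Lemma mark_mean_sum ys (c : R) (h : (R * R) * R -> R) : (0 <= c)%R ->
  (forall y l, 0 <= l <= K -> 0 <= h (y, l))%R ->
  (forall y, measurable_fun `[0%R, K]%classic
     ((fun l => h (y, l)) : measurableTypeR R -> R)) ->
  mark_mean K nu ys (fun ps => (c + \sum_(p <- ps) h p)%:E) =
  c%:E + \sum_(y <- ys) \int[nu]_(l in `[0%R, K]) (h (y, l))%:E.
Proof.
(* The constant stays general: it collects the score of each mark already drawn. *)
move=> + h0 mh; elim: ys c => [|y ys IH] c c0 /=;
  first by rewrite !big_nil addr0 adde0.
have hE0 z (l : R) : `[0%R, K]%classic l -> 0 <= (h (z, l))%:E.
  by rewrite /= in_itv/= lee_fin; exact: h0.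
under eq_integral => l.
  rewrite inE /= in_itv/= => l0K.
  under eq_fun do rewrite big_cons addrA.
  rewrite (IH _ (addr_ge0 c0 (h0 y l l0K))) EFinD -addeA addeCA; over.
have S0 : 0 <= \sum_(z <- ys) \int[nu]_(l in `[0%R, K]) (h (z, l))%:E.
  by apply: sume_ge0 => z _; apply: integral_ge0 => l; exact: hE0.
rewrite ge0_integralD//; last 3 first.
- by move=> l; exact: hE0.
- by apply/measurable_EFinP; exact: mh.
- by move=> l _; rewrite adde_ge0 ?lee_fin.
by rewrite integral_cst_marks big_cons addeCA.
Qed.

End marks.

(** * Range, measurability and recursion of the one-point scores *)

Section scores.
Context {R : realType} (W : set (R * R)) (K pd beta alpha : R) (g : R -> R).
Hypotheses (pd_gt0 : 0 < pd) (pd_lt1 : pd < 1) (beta_gt0 : 0 < beta).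
Hypotheses (K_gt0 : 0 < K) (alpha_ge0 : 0 <= alpha) (alpha_lt1 : alpha < 1).
Hypothesis g_range : forall m, 0 <= m <= K -> 0 <= g m <= K.
Hypothesis g_cont : {within `[0, K], continuous g}.

Local Notation c := (alpha * (1 - pd)).
Local Notation shat := (shat pd alpha g).
Local Notation stilde := (stilde W K pd beta alpha g).

Let c_ge0 : 0 <= c. Proof. by rewrite mulr_ge0// subr_ge0 ltW. Qed.

Let c_le1 : c <= 1.
Proof. by rewrite mulr_ile1// ?subr_ge0 ?gerBl ltW. Qed.

Lemma iter_growth_range j m : 0 <= m <= K -> 0 <= iter j g m <= K.
Proof. by move=> m0K; elim: j => //= j; exact: g_range. Qed.

(** Continuity of [g] is given on [0, K] only; the iterates stay there, so they can be composed as
    measurable functions on that interval. *)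
Lemma iter_growth_measurable j : measurable_fun `[0, K]%classic
  (iter j g : measurableTypeR R -> R).
Proof.
elim: j => [|j IH]; first exact: measurable_id.
apply: (@measurable_comp _ _ _ _ _ _ `[0, K]%classic g) => //.
  move=> _ [m /= m0K <-]; move: m0K; rewrite /= !in_itv/=.
  exact: iter_growth_range.
by apply: subspace_continuous_measurable_fun => //; exact: measurable_itv.
Qed.

Lemma bigmax_measurable d (T : measurableType d) (D : set T) n (f0 : T -> R) (f : 'I_n -> T -> R) :
  measurable_fun D f0 -> (forall i, measurable_fun D (f i)) ->
  measurable_fun D (fun x => \big[Num.max/f0 x]_(i < n) f i x).
Proof.
move=> mf0; elim: n f => [|n IH] f mf.
  by under eq_fun do rewrite big_ord0.
under eq_fun do rewrite big_ord_recl.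
by apply: measurable_maxr => //; apply: IH.
Qed.

Lemma shat_ge0 n m : 0 <= m -> 0 <= shat n m.
Proof.
case: n => //= n m0; apply: le_trans m0 _; exact: bigmax_ge_id.
Qed.

Lemma shat_ge n m : m <= shat n.+1 m.
Proof. exact: bigmax_ge_id. Qed.

Lemma iter_score_le j m : 0 <= m <= K ->
  alpha ^+ j * (1 - pd) ^+ j * iter j g m <= K.
Proof.
move=> /(iter_growth_range j)/andP[i0 iK]; rewrite -exprMn.
by apply: le_trans iK; rewrite ler_piMl// exprn_ile1.
Qed.

Lemma shat_le n m : 0 <= m <= K -> shat n m <= K.
Proof.
move=> m0K; case: n => [|n] /=; first exact: ltW.
by apply: bigmax_le => [|j _]; [case/andP: m0K|exact: iter_score_le].
Qed.

Lemma shat_measurable n :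
  measurable_fun `[0, K]%classic (shat n : measurableTypeR R -> R).
Proof.
case: n => [|n] /=; first exact: measurable_cst.
apply: bigmax_measurable; first exact: measurable_id.
by move=> j; apply: measurable_funM => //; exact: iter_growth_measurable.
Qed.

(** Multiplying the term of index [j] at [g m] by [c] gives the term of index [j + 1] at [m], which
    the larger maximum includes. *)
Lemma shat_grow n m : 0 <= m -> c * shat n (g m) <= shat n.+1 m.
Proof.
move=> m0; case: n => [|n]; first by rewrite mulr0 shat_ge0.
have shatE (j : 'I_n.+1) :
    c * (alpha ^+ j * (1 - pd) ^+ j * iter j g (g m)) <= shat n.+2 m.
  have -> : c * (alpha ^+ j * (1 - pd) ^+ j * iter j g (g m)) =
      alpha ^+ j.+1 * (1 - pd) ^+ j.+1 * iter j.+1 g m.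
    by rewrite -iterSr -!exprMn mulrA -exprS.
  by apply: (le_bigmax _ _ (lift ord0 j)).
(* The default value of the maximum is its term of index 0, hence the case [ord0]. *)
rewrite {1}/shat; apply: (big_ind (fun x => c * x <= shat n.+2 m)) => [|x y|] //.
  by have := shatE ord0; rewrite !expr0 !mul1r.
by move=> cx cy; rewrite /Num.max; case: ifP.
Qed.

(** An upper bound for the mean score of the births rejected because of a point at [y]: their
    expected number times the largest score [K]. *)
Definition birth_loss (y : R * R) : R :=
  K * beta * fine (area (cball y K `&` W)%classic).

Lemma birth_loss_ge0 y : 0 <= birth_loss y.
Proof.
by rewrite mulr_ge0 ?fine_ge0// mulr_ge0 ?ltW.
Qed.

Lemma stildeE n y m : stilde n.+1 y m =
  \big[Num.max/m]_(j < n.+1) (c ^+ j * iter j g m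
     - alpha * birth_loss y * \sum_(i < j) c ^+ i).
Proof.
apply: eq_bigr => j _; rewrite exprMn /birth_loss !mulrA.
by congr (_ - _ * _); apply: eq_bigr => i _; rewrite exprMn.
Qed.

Lemma stilde_ge n y m : m <= stilde n.+1 y m.
Proof. exact: bigmax_ge_id. Qed.

Lemma stilde_ge0 n y m : 0 <= m -> 0 <= stilde n y m.
Proof.
case: n => //= n m0; apply: le_trans m0 _; exact: bigmax_ge_id.
Qed.

Lemma stilde_le n y m : 0 <= m <= K -> stilde n y m <= K.
Proof.
move=> m0K; case: n => [|n]; first exact: ltW.
rewrite stildeE; apply: bigmax_le => [|j _]; first by case/andP: m0K.
rewrite -[leRHS]subr0 lerB//.
  by rewrite exprMn; exact: iter_score_le.
apply: mulr_ge0; first by rewrite mulr_ge0// birth_loss_ge0.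
by apply: sumr_ge0 => i _; rewrite exprn_ge0.
Qed.

Lemma stilde_measurable n y :
  measurable_fun `[0, K]%classic (stilde n y : measurableTypeR R -> R).
Proof.
case: n => [|n] /=; first exact: measurable_cst.
apply: bigmax_measurable; first exact: measurable_id.
move=> j; apply: measurable_funB => //.
by apply: measurable_funM => //; exact: iter_growth_measurable.
Qed.

(** The term of index 0 is [m]. For index [j + 1], the geometric sum equals 1 plus [c] times the sum
    for [j]; the 1 yields one loss and the rest is [c] times the term of index [j] at [g m]. *)
Lemma stilde_grow n y m : 0 <= m ->
  stilde n.+1 y m <= Num.max m (c * stilde n y (g m) - alpha * birth_loss y).
Proof.
move=> m0; rewrite stildeE; apply: bigmax_le => [|[[|j] /= jn] _].
- by rewrite le_max lexx.
- by rewrite big_ord0 expr0 mul1r mulr0 subr0 le_max lexx.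
case: n jn => // n jn; rewrite le_max; apply/orP; right.
rewrite big_ord_recl expr0; under eq_bigr do rewrite exprS.
rewrite -mulr_sumr exprS -iterS iterSr.
set S := \sum_(_ < _) _; rewrite stildeE.
have := @le_bigmax _ _ _ (g m) (fun j : 'I_n.+1 => c ^+ j * iter j g (g m)
     - alpha * birth_loss y * \sum_(i < j) c ^+ i) (Ordinal (jn : (j < n.+1)%N)).
rewrite /= -/S; set B := \big[_/_]_(_ < _) _.
by move=> /(ler_wpM2l c_ge0); lra.
Qed.

End scores.

(** * Splitting sums over a state and shifting discounted sums *)

Lemma big_fsetD_split {R : realType} {T : choiceType} (a x : {fset T}) (f : T -> R) :
  a `<=` x -> \sum_(p <- x) f p = \sum_(p <- x `\` a) f p + \sum_(p <- a) f p.
Proof.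
move=> ax; rewrite (big_fsetID _ (mem a)) /= addrC; congr (_ + _).
  by apply: eq_fbigl => p; rewrite !inE /= andbC.
apply: eq_fbigl => p; rewrite !inE /=; apply: andb_idl; exact: (fsubsetP ax).
Qed.

(** For positive [n] this is an index shift with the first term split off; [I 0 = 0] covers [n = 0],
    where the left sum is empty. *)
Lemma discounted_sumS {R : realType} (alpha : R) (I : nat -> R) n : I 0%N = 0 ->
  \sum_(1 <= k < n.+1) alpha ^+ k * I (n.+1 - k)%N =
  alpha * (I n + \sum_(1 <= k < n) alpha ^+ k * I (n - k)%N).
Proof.
move=> I0; case: n => [|n]; first by rewrite !big_geq// I0 addr0 mulr0.
rewrite big_ltn// subSS subn0 expr1 mulrDr big_add1 /= mulr_sumr; congr (_ + _).
by apply: eq_bigr => k _; rewrite exprS mulrA subSS.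
Qed.

Section next_state.
Context {R : realType} (W : set (R * R)) (K : R) (g : R -> R).
Hypothesis K_gt0 : 0 < K.
Hypothesis g_range : forall m, 0 <= m <= K -> 0 <= g m <= K.
Local Notation mpoint := ((R * R) * R)%type.

Definition admissible (a : {fset mpoint}) (y : R * R) : bool :=
  all (fun q => ~~ (eucl_dist q.1 y <= K)) (enum_fset a).

Lemma eucl_distxx (y : R * R) : eucl_dist y y = 0.
Proof. by rewrite /eucl_dist !subrr expr0n addr0 sqrtr0. Qed.

Lemma eucl_distC (y z : R * R) : eucl_dist y z = eucl_dist z y.
Proof.
by rewrite /eucl_dist -(opprB y.1) -(opprB y.2) !sqrrN.
Qed.

Lemma mem_next (s a : {fset mpoint}) (ps : seq mpoint) q :
  q \in grow g s `|` admit_births K a ps ->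
  (exists2 p, p \in s & q = (p.1, g p.2)) \/ (q \in ps /\ admissible a q.1).
Proof.
rewrite inE => /orP[/imfsetP[p /= ps' ->]|]; first by left; exists p.
by rewrite !inE /= => /andP[qps qa]; right.
Qed.

Lemma next_marks (s a : {fset mpoint}) ps :
  (forall p, p \in s -> 0 <= p.2 <= K) -> (forall p, p \in ps -> 0 <= p.2 <= K) ->
  forall p, p \in grow g s `|` admit_births K a ps -> 0 <= p.2 <= K.
Proof.
move=> sK psK q /mem_next[[p ps' ->]|[qps _]]; last exact: psK.
exact/g_range/sK.
Qed.

(** Every point of the next state is a grown survivor or a birth, so counting all of these, rejected
    births included, can only increase a nonnegative sum. *)
Lemma sum_next_le (f : mpoint -> R) (s a : {fset mpoint}) ps :
  (forall p, 0 <= p.2 <= K -> 0 <= f p) ->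
  (forall p, p \in s -> 0 <= p.2 <= K) -> (forall p, p \in ps -> 0 <= p.2 <= K) ->
  \sum_(p <- grow g s `|` admit_births K a ps) f p <=
  \sum_(p <- s) f (p.1, g p.2) + \sum_(p <- ps) f p.
Proof.
move=> f0 sK psK.
rewrite -(big_map (fun p : mpoint => (p.1, g p.2)) xpredT f) -big_cat.
apply: le_sum_uniq_sub; first exact: fset_uniq.
  move=> q /mem_next[[p ps' ->]|[qps _]]; rewrite mem_cat; last by rewrite qps orbT.
  by apply/orP; left; apply/mapP; exists p.
move=> q; rewrite mem_cat => /orP[/mapP[p ps' ->]|/psK /f0//].
exact/f0/g_range/sK.
Qed.

Lemma sum_next_ge (f : mpoint -> R) (s a : {fset mpoint}) ps :
  state_space W K a -> s `<=` a -> uniq [seq p.1 | p <- ps] ->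
  (forall p, 0 <= p.2 <= K -> 0 <= f p) -> (forall p, p \in ps -> 0 <= p.2 <= K) ->
  \sum_(p <- s) f (p.1, g p.2) + \sum_(p <- ps | admissible a p.1) f p <=
  \sum_(p <- grow g s `|` admit_births K a ps) f p.
Proof.
move=> [aK a_inj _] sa ups f0 psK.
rewrite -(big_map (fun p : mpoint => (p.1, g p.2)) xpredT f) -(big_filter ps) -big_cat.
apply: le_sum_uniq_sub.
- rewrite cat_uniq; apply/and3P; split.
  (* Distinct locations make growth injective on [s], even where [g] identifies marks. *)
  + rewrite map_inj_in_uniq ?fset_uniq// => p q ps' qs [pq _].
    apply/eqP; apply: contraT => /(a_inj p q (fsubsetP sa _ ps') (fsubsetP sa _ qs)).
    by rewrite pq eqxx.
  (* A birth at the location of a survivor is at distance 0 from a point of [a], hence rejected. *)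
  + apply/hasPn => q; rewrite mem_filter => /andP[qa _].
    apply/negP => /mapP[p ps' qE]; move: qa => /allP /(_ p (fsubsetP sa _ ps')).
    by rewrite qE /= eucl_distxx ltW.
  + exact/filter_uniq/(map_uniq ups).
- move=> q; rewrite mem_cat => /orP[/mapP[p ps' ->]|].
    by rewrite inE; apply/orP; left; apply/imfsetP; exists p.
  by rewrite mem_filter => /andP[qa qps]; rewrite !inE /= qps; apply/orP; right.
- move=> q /(next_marks _ psK) qK; apply/f0/qK => p /(fsubsetP sa) /aK.
  by case.
Qed.

Lemma next_state_space (s a : {fset mpoint}) ps :
  state_space W K a -> s `<=` a -> uniq [seq p.1 | p <- ps] ->
  (forall p, p \in ps -> W p.1) -> (forall p, p \in ps -> 0 <= p.2 <= K) ->
  (forall p q, p \in ps -> q \in ps -> p.1 != q.1 -> ~~ (eucl_dist p.1 q.1 <= K)) ->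
  state_space W K (grow g s `|` admit_births K a ps).
Proof.
move=> [aK a_inj a_hc] sa ups psW psK ps_hc.
(* Births are tested against all of [a], hence in particular against the survivors in [s]. *)
have far (p q : mpoint) : p \in s -> admissible a q.1 -> ~~ (eucl_dist p.1 q.1 <= K).
  by move=> ps' /allP; apply; exact: (fsubsetP sa).
split.
- move=> q qx; split; last first.
    by apply: (next_marks _ psK qx) => p /(fsubsetP sa) /aK; case.
  case/mem_next: qx => [[p ps' ->]|[qps _]]; last exact: psW.
  by have [] := aK p (fsubsetP sa _ ps').
- move=> p q /mem_next[[p' p's ->]|[pps pa]] /mem_next[[q' q's ->]|[qps qa]] /=.
  + move=> pq; apply: a_inj; rewrite ?(fsubsetP sa)//.
    by apply: contra pq => /eqP ->.
  + move=> _; apply: contra (far _ _ p's qa) => /eqP ->.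
    by rewrite eucl_distxx ltW.
  + move=> _; apply: contra (far _ _ q's pa) => /eqP ->.
    by rewrite eucl_distxx ltW.
  (* Two births at one location have the same index in the duplicate-free list of locations, so they
     coincide. *)
  + move=> pq; apply: contra pq => /eqP pq1.
    have := ups; move=> /(uniqP (0, 0)) u; rewrite -(nth_index p pps) -(nth_index p qps).
    apply/eqP; congr nth; apply: u; rewrite ?inE ?size_map ?index_mem//.
    by rewrite !(nth_map p) ?index_mem// !nth_index.
- move=> p q /mem_next[[p' p's ->]|[pps pa]] /mem_next[[q' q's ->]|[qps qa]] /=.
  + by apply: a_hc; rewrite (fsubsetP sa).
  + by move=> _; exact: far.
  + by move=> _; rewrite eucl_distC; exact: far.
  + exact: ps_hc.
Qed.

End next_state.

(** * One-step bounds and the induction for the value functions *)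

Section bounds.
Context {R : realType} d {Omega : measurableType d} (P : probability Omega R).
Context (W : set (R * R)) (K Rw pd beta alpha : R) (g : R -> R).
Context (nu : probability (measurableTypeR R) R) (Phi : Omega -> {fset R * R}).
Hypotheses (compW : compact W) (K_gt0 : 0 < K) (Rw_gt0 : 0 < Rw).
Hypotheses (pd_gt0 : 0 < pd) (pd_lt1 : pd < 1) (beta_gt0 : 0 < beta).
Hypotheses (alpha_ge0 : 0 <= alpha) (alpha_lt1 : alpha < 1).
Hypothesis g_range : forall m, 0 <= m <= K -> 0 <= g m <= K.
Hypothesis g_cont : {within `[0, K], continuous g}.
Hypothesis nu_supp : nu `[0, K]%classic = 1%E.
Hypothesis birth : hard_core_process W K beta P Phi.

Local Notation mpoint := ((R * R) * R)%type.
Local Notation R2 := (measurableTypeR R * measurableTypeR R)%type.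
Local Notation shat := (shat pd alpha g).
Local Notation stilde := (stilde W K pd beta alpha g).
Local Notation loss := (birth_loss W K beta).
Local Notation next_mean := (next_mean P K pd g nu Phi).
Local Notation value := (value P W K Rw pd alpha g nu Phi).
Local Notation lambda2 := (@lebesgue_measure R \x @lebesgue_measure R)%E.
Local Notation marks_ok x := (forall p : mpoint, p \in x -> 0 <= p.2 <= K).

Let Rw_ge0 : 0 <= Rw := ltW Rw_gt0.

Let beta_ge0 : 0 <= beta := ltW beta_gt0.

Let K_ge0 : 0 <= K := ltW K_gt0.

Let mW : measurable (W : set R2) := prod_compact_measurable compW.

Let area_fin (B : set R2) : measurable B -> (B `<=` W)%classic ->
  area B \is a fin_num.
Proof.
move=> mB BW; rewrite ge0_fin_numE//.
by apply: le_lt_trans (prod_compact_area_fin compW); apply: le_measure; rewrite ?inE.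
Qed.

Let mark_integral_fin (f : R -> R) : (forall l, 0 <= l <= K -> 0 <= f l <= K) ->
  exists2 v : R, (\int[nu]_(l in `[0%R, K]) (f l)%:E = v%:E)%E & 0 <= v <= K.
Proof.
move=> fK; set I := (\int[nu]_(l in _) _)%E.
have I0 : (0 <= I)%E.
  by apply: integral_ge0 => l; rewrite /= in_itv/= lee_fin => /fK/andP[].
have IK : (I <= K%:E)%E.
  rewrite -(integral_cst_marks nu_supp K%:E).
  apply: ge0_le_integral_nonmeas => l; rewrite /= in_itv/= lee_fin => /fK/andP[]//.
have If : I \is a fin_num.
  by rewrite ge0_fin_numE//; apply: le_lt_trans IK _; rewrite ltry.
exists (fine I); rewrite ?fineK//.
by rewrite -!lee_fin fineK ?I0.
Qed.

(** It suffices to bound the birth integral, for each survivor set, by an additive functional of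
    that set; averaging over deaths then produces the factor [1 - pd]. *)
Lemma next_mean_le F (a : {fset mpoint}) (f : mpoint -> R) (C : R) :
  (forall s, s `<=` a ->
    \int[P]_w mark_mean K nu (enum_fset (Phi w))
      (fun ps => F (grow g s `|` admit_births K a ps))
    <= (\sum_(q <- s) f q + C)%:E)%E ->
  (next_mean F a <= ((1 - pd) * (\sum_(q <- a) f q) + C)%:E)%E.
Proof.
move=> hQ; rewrite -thinning_sum -sumEFin /next_mean big_seq [leRHS]big_seq.
apply: lee_sum => s; rewrite fpowersetE => sa; rewrite [leRHS]EFinM.
apply: lee_wpmul2l; last exact: hQ.
by rewrite lee_fin mulr_ge0// exprn_ge0// ?subr_ge0 ltW.
Qed.

Lemma next_mean_ge F (a : {fset mpoint}) (f : mpoint -> R) (C : R) :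
  (forall s, s `<=` a ->
    (\sum_(q <- s) f q + C)%:E <=
    \int[P]_w mark_mean K nu (enum_fset (Phi w))
      (fun ps => F (grow g s `|` admit_births K a ps)))%E ->
  (((1 - pd) * (\sum_(q <- a) f q) + C)%:E <= next_mean F a)%E.
Proof.
move=> hQ; rewrite -thinning_sum -sumEFin /next_mean big_seq [leRHS]big_seq.
apply: lee_sum => s; rewrite fpowersetE => sa; rewrite [leLHS]EFinM.
apply: lee_wpmul2l; last exact: hQ.
by rewrite lee_fin mulr_ge0// exprn_ge0// ?subr_ge0 ltW.
Qed.

Lemma mem_actions (x a : {fset mpoint}) :
  (a \in actions W K x) = (a `<=` x) && `[< state_space W K a >].
Proof. by rewrite !inE /= fpowersetE. Qed.

Lemma state_space_sub (x a : {fset mpoint}) :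
  state_space W K x -> a `<=` x -> state_space W K a.
Proof.
move=> [xW xinj xhc] /fsubsetP ax; split.
- by move=> p /ax; exact: xW.
- by move=> p q /ax px /ax; exact: xinj.
- by move=> p q /ax px /ax; exact: xhc.
Qed.

Lemma state_space0 : state_space W K (fset0 : {fset mpoint}).
Proof. by split => p. Qed.

Lemma value_ge_action n (x a : {fset mpoint}) : a \in actions W K x ->
  ((reward Rw x a)%:E + alpha%:E * next_mean (value n) a <= value n.+1 x)%E.
Proof.
by move=> ax; exact: (le_bigmax_seq _ _ _ _ ax isT).
Qed.

(** Retaining nothing is always allowed and earns a nonnegative reward. Only the marks are
    constrained, so that the bound covers also the null set of outcomes whose births violate the
    hard core condition. *)
Lemma value_ge0 n (x : {fset mpoint}) : marks_ok x -> (0 <= value n x)%E.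
Proof.
elim: n x => [|n IH] x xK; first by [].
apply: le_trans (value_ge_action n (a := fset0) _); last first.
  by rewrite mem_actions fsub0set; apply/asboolP/state_space0.
apply: adde_ge0.
  rewrite lee_fin mulr_ge0// big_seq sumr_ge0// => p.
  by rewrite inE => /andP[_ /xK/andP[]].
apply: mule_ge0; first by rewrite lee_fin.
rewrite -[0%E]/((0 : R)%:E).
(* Zero is put in the shape required by [next_mean_ge], with [f = 0] and [C = 0]. *)
have -> : 0 = (1 - pd) * (\sum_(q <- (fset0 : {fset mpoint})) 0) + 0 :> R.
  by rewrite big1// mulr0 addr0.
apply: next_mean_ge => s; rewrite fsubset0 => /eqP ->; rewrite big1// addr0.
apply: integral_ge0 => w _.
suff /andP[] : (0 <= mark_mean K nu (enum_fset (Phi w))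
    (fun ps => value n (grow g fset0 `|` admit_births K fset0 ps)) <=
  mark_mean K nu (enum_fset (Phi w))
    (fun ps => value n (grow g fset0 `|` admit_births K fset0 ps)))%E by [].
apply: mark_mean_le => ps _ psK; rewrite lexx andbT; apply: IH.
exact: (next_marks g_range).
Qed.

(** * The upper bound *)

Section upper.

Let J n : R := fine (\int[nu]_(l in `[0%R, K]) (shat n l)%:E)%E.

Let J_spec n : (\int[nu]_(l in `[0%R, K]) (shat n l)%:E = (J n)%:E)%E /\ 0 <= J n.
Proof.
have [|v e /andP[v0 _]] := @mark_integral_fin (shat n).
  move=> l lK; rewrite shat_ge0 ?shat_le//; by case/andP: lK.
by rewrite /J e.
Qed.

Let C n : R := Rw * beta * fine (area W) * \sum_(1 <= k < n) alpha ^+ k * J (n - k)%N.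

Let A_ge0 : 0 <= fine (area W). Proof. by rewrite fine_ge0. Qed.

Let C_ge0 n : 0 <= C n.
Proof.
apply: mulr_ge0; first by rewrite !mulr_ge0.
by apply: sumr_ge0 => k _; rewrite mulr_ge0 ?exprn_ge0// (J_spec _).2.
Qed.

Let CS n : C n.+1 = alpha * (C n + Rw * beta * fine (area W) * J n).
Proof.
rewrite /C discounted_sumS; first by lra.
by rewrite /J integral0_eq.
Qed.

(** All terms are finite, so the comparison can be carried out with real numbers; [C n] is the birth
    part. *)
Lemma vhatE n (x : {fset mpoint}) :
  vhat W K Rw pd beta alpha g nu n x =
  (Rw * \sum_(p <- x) shat n p.2 + C n)%:E.
Proof.
rewrite /vhat EFinD; congr (_ + _)%E; rewrite /C [RHS]EFinM [X in _ = (X * _)%E]EFinM fineK//; last exact: area_fin.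
congr (_ * _)%E; rewrite -sumEFin; apply: eq_bigr => k _.
by rewrite (J_spec _).1 EFinM.
Qed.

Lemma birth_number_mean (c j : R) : 0 <= c -> 0 <= j ->
  (\int[P]_w (c + j * (npoints W (Phi w))%:R)%:E =
   (c + j * (beta * fine (area W)))%:E)%E.
Proof.
move=> c0 j0; under eq_integral do rewrite EFinD EFinM.
have mN : measurable_fun setT (fun w => (npoints W (Phi w))%:R : R).
  exact: (npoints_measurable birth).
rewrite ge0_integralD//.
- rewrite integral_cst// [X in (c%:E * X)%E](probability_setT P) mule1.
  rewrite ge0_integralZl_EFin//; last exact/measurable_EFinP.
  by rewrite (npoints_mean birth)// EFinD !EFinM fineK//; exact: area_fin.
- by move=> w _; rewrite -EFinM lee_fin mulr_ge0.
- by under eq_fun do rewrite -EFinM; apply/measurable_EFinP; exact: measurable_funM.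
Qed.

Lemma next_vhat_le n (s a : {fset mpoint}) (F : {fset mpoint} -> \bar R) :
  marks_ok s ->
  (forall x, marks_ok x -> 0 <= F x <= vhat W K Rw pd beta alpha g nu n x)%E ->
  (\int[P]_w mark_mean K nu (enum_fset (Phi w))
      (fun ps => F (grow g s `|` admit_births K a ps))
   <= (\sum_(q <- s) (Rw * shat n (g q.2)) +
       (C n + Rw * beta * fine (area W) * J n))%:E)%E.
Proof.
move=> sK FK.
have s0 : 0 <= \sum_(q <- s) (Rw * shat n (g q.2)) + C n.
  rewrite addr_ge0// big_seq sumr_ge0// => q /sK qK.
  by rewrite mulr_ge0// shat_ge0//; have /andP[] := g_range qK.
(* The last summand is the mean score [Rw * J n] of a birth times the expected number of births;
   this allows a pathwise comparison with the actual number. *)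
have -> : \sum_(q <- s) (Rw * shat n (g q.2)) + (C n + Rw * beta * fine (area W) * J n) =
   (\sum_(q <- s) (Rw * shat n (g q.2)) + C n) + (Rw * J n) * (beta * fine (area W)).
  by lra.
rewrite -birth_number_mean//; last by rewrite mulr_ge0 ?(J_spec _).2.
have step w : (0 <= mark_mean K nu (enum_fset (Phi w))
      (fun ps => F (grow g s `|` admit_births K a ps)) <=
    (\sum_(q <- s) (Rw * shat n (g q.2)) + C n +
                     Rw * J n * (npoints W (Phi w))%:R)%:E)%E.
  have <- : mark_mean K nu (enum_fset (Phi w)) (fun ps =>
      (\sum_(q <- s) (Rw * shat n (g q.2)) + C n + \sum_(p <- ps) Rw * shat n p.2)%:E) =
    (\sum_(q <- s) (Rw * shat n (g q.2)) + C n +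
                     Rw * J n * (npoints W (Phi w))%:R)%:E.
    rewrite (@mark_mean_sum _ _ _ nu_supp _ _ (fun p => Rw * shat n p.2))//; last 2 first.
    - by move=> _ l /andP[l0 _] /=; rewrite mulr_ge0 ?shat_ge0.
    - by move=> _ /=; apply: measurable_funM => //; exact: shat_measurable.
    rewrite [RHS]EFinD; congr (_ + _)%E; rewrite npointsE mulr_sumr -sumEFin.
    rewrite big_seq [RHS]big_seq; apply: eq_bigr => y yw.
    (* All births lie in [W], so the count over [W] includes each of them. *)
    rewrite indicE mem_set; last by case: birth => PhiW _ _ _; exact: PhiW yw.
    rewrite mulr1; under eq_integral do rewrite EFinM.
    rewrite ge0_integralZl_EFin//.
    + by rewrite (J_spec n).1 EFinM.
    + by move=> l; rewrite /= in_itv/= lee_fin => /andP[l0 _]; exact: shat_ge0.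
    + by apply/measurable_EFinP; exact: shat_measurable.
  apply: mark_mean_le => ps _ psK.
  have nK : marks_ok (grow g s `|` admit_births K a ps) by exact: next_marks.
  have /andP[-> /= /le_trans] := FK _ nK; apply.
  rewrite vhatE lee_fin -addrA (addrC (C n)) addrA lerD2r mulr_sumr.
  apply: (@sum_next_le _ _ _ g_range (fun p => Rw * shat n p.2)) => //.
  by move=> p /andP[p0 _]; rewrite mulr_ge0 ?shat_ge0.
by apply: ge0_le_integral_nonmeas => w _; have /andP[] := step w.
Qed.

Lemma value_le_vhat n (x : {fset mpoint}) : marks_ok x ->
  (value n x <= vhat W K Rw pd beta alpha g nu n x)%E.
Proof.
elim: n x => [|n IH] x xK; rewrite vhatE.
  rewrite /C big_geq// mulr0 addr0 lee_fin mulr_ge0//.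
  by rewrite big1.
rewrite [value _ _]/= big_seq; apply: bigmax_le => [|a]; first exact: leNye.
rewrite mem_actions => /andP[ax _].
have aK : marks_ok a by move=> p /(fsubsetP ax); exact: xK.
have next_le : (next_mean (value n) a <= ((1 - pd) *
    (\sum_(q <- a) (Rw * shat n (g q.2))) +
    (C n + Rw * beta * fine (area W) * J n))%:E)%E.
  apply: next_mean_le => s sa; apply: next_vhat_le => [p /(fsubsetP sa)|y yK].
    exact: aK.
  by rewrite value_ge0//= IH.
apply: le_trans (leeD2l _ (lee_wpmul2l _ next_le)) _; first by rewrite lee_fin.
rewrite -EFinM -EFinD lee_fin CS /reward -mulr_sumr (big_fsetD_split _ ax).
have keep : \sum_(p <- a) alpha * (1 - pd) * shat n (g p.2) <=
    \sum_(p <- a) shat n.+1 p.2.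
  rewrite big_seq [leRHS]big_seq; apply: ler_sum => p /aK /andP[p0 _].
  exact: shat_grow.
have harvest : \sum_(p <- x `\` a) p.2 <= \sum_(p <- x `\` a) shat n.+1 p.2.
  by apply: ler_sum => p _; exact: shat_ge.
rewrite -mulr_sumr in keep.
set S1 := \sum_(p <- x `\` a) shat n.+1 p.2 in harvest *.
set S2 := \sum_(p <- a) shat n.+1 p.2 in keep *.
set S3 := \sum_(p <- _) p.2 in harvest *.
set S4 := \sum_(p <- _) shat n _ in keep *.
have := ler_wpM2l Rw_ge0 (lerD harvest keep); lra.
Qed.

End upper.

(** * The lower bound *)

Section lower.

Let h n (y : R * R) : R := fine (\int[nu]_(l in `[0%R, K]) (stilde n y l)%:E)%E.

Let h_spec n y :
  (\int[nu]_(l in `[0%R, K]) (stilde n y l)%:E = (h n y)%:E)%E /\ 0 <= h n y <= K.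
Proof.
have [|v e vK] := @mark_integral_fin (stilde n y).
  move=> l lK; rewrite stilde_ge0 ?stilde_le//; by case/andP: lK.
by rewrite /h e.
Qed.

Let I n : R := fine (\int[lambda2]_(y in W) (h n y)%:E)%E.

Let I_spec n : (\int[lambda2]_(y in W) (h n y)%:E = (I n)%:E)%E /\ 0 <= I n.
Proof.
have I0 : (0 <= \int[lambda2]_(y in W) (h n y)%:E)%E.
  by apply: integral_ge0 => y _; rewrite lee_fin; have [_ /andP[]] := h_spec n y.
rewrite /I; split; last exact: fine_ge0.
rewrite fineK// ge0_fin_numE//.
apply: (@le_lt_trans _ _ (\int[lambda2]_(y in W) K%:E)%E).
  apply: ge0_le_integral_nonmeas => y _; rewrite lee_fin;
  by have [_ /andP[]] := h_spec n y.
rewrite integral_cst//; apply: lte_mul_pinfty => //.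
exact: prod_compact_area_fin.
Qed.

Let C n : R := Rw * beta * \sum_(1 <= k < n) alpha ^+ k * I (n - k)%N.

Let C_ge0 n : 0 <= C n.
Proof.
apply: mulr_ge0; first by rewrite mulr_ge0.
by apply: sumr_ge0 => k _; rewrite mulr_ge0 ?exprn_ge0// (I_spec _).2.
Qed.

Let CS n : C n.+1 = alpha * (C n + Rw * beta * I n).
Proof.
rewrite /C discounted_sumS; first by lra.
by rewrite /I integral0_eq// => y _; rewrite /h integral0_eq.
Qed.

Lemma vtildeE n (x : {fset mpoint}) :
  vtilde W K Rw pd beta alpha g nu n x =
  (Rw * \sum_(p <- x) stilde n p.1 p.2 + C n)%:E.
Proof.
rewrite /vtilde EFinD; congr (_ + _)%E; rewrite /C [RHS]EFinM.
congr (_ * _)%E; rewrite -sumEFin; apply: eq_bigr => k _.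
rewrite EFinM -(I_spec _).1; congr (_ * _)%E.
by apply: eq_integral => y _; rewrite (h_spec _ _).1.
Qed.

(** A pathwise bound for the score lost to rejection: each birth in the ball of a retained point is
    charged the maximal [Rw * K]. Its mean is the sum of the losses, times [Rw]. *)
Let U (a : {fset mpoint}) (w : Omega) : R :=
  \sum_(p <- a) Rw * K * (npoints (cball p.1 K `&` W)%classic (Phi w))%:R.

Let ball_measurable (p : mpoint) :
  measurable ((cball p.1 K `&` W)%classic : set R2).
Proof. by apply: measurableI => //; exact: cball_measurable. Qed.

Let U_mean a : (\int[P]_w (U a w)%:E = (Rw * \sum_(p <- a) loss p.1)%:E)%E.
Proof.
have mN (p : mpoint) : measurable_fun setT
    (fun w => (npoints (cball p.1 K `&` W)%classic (Phi w))%:R : R).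
  exact: (npoints_measurable birth (ball_measurable p)).
under eq_integral do rewrite -sumEFin.
rewrite ge0_integral_sum//; last 2 first.
- by move=> p; apply/measurable_EFinP; exact: measurable_funM.
- by move=> p w _; rewrite lee_fin mulr_ge0// mulr_ge0.
rewrite mulr_sumr -sumEFin; apply: eq_bigr => p _.
under eq_integral do rewrite EFinM.
rewrite ge0_integralZl_EFin//; last 2 first.
- exact/measurable_EFinP.
- by rewrite mulr_ge0.
have ballW : (cball p.1 K `&` W `<=` W)%classic by move=> y [].
rewrite (npoints_mean birth (ball_measurable p) ballW).
rewrite -[area _]fineK; last exact: (area_fin (ball_measurable p) ballW).
by rewrite -!EFinM /birth_loss; congr (_%:E); lra.
Qed.

(** Two hypotheses on [F] are needed: the lower bound applies where the births satisfy the hard core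
    condition, so that the next state lies in the state space, and nonnegativity handles the
    remaining outcomes. *)
Lemma le_next_vtilde n (s a : {fset mpoint}) (F : {fset mpoint} -> \bar R) :
  state_space W K a -> s `<=` a ->
  (forall x, marks_ok x -> 0 <= F x)%E ->
  (forall x, state_space W K x -> vtilde W K Rw pd beta alpha g nu n x <= F x)%E ->
  ((\sum_(q <- s) (Rw * stilde n q.1 (g q.2)) +
    (C n + Rw * beta * I n - Rw * \sum_(p <- a) loss p.1))%:E <=
   \int[P]_w mark_mean K nu (enum_fset (Phi w))
      (fun ps => F (grow g s `|` admit_births K a ps)))%E.
Proof.
move=> aX sa F0 FX.
have aK : marks_ok a by move=> p pa; have [/(_ p pa)[]] := aX.
have sK : marks_ok s by move=> p /(fsubsetP sa); exact: aK.
have nextK ps : marks_ok ps -> marks_ok (grow g s `|` admit_births K a ps).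
  by move=> psK; exact: next_marks.
have s0 : 0 <= \sum_(q <- s) (Rw * stilde n q.1 (g q.2)) + C n.
  rewrite addr_ge0// big_seq sumr_ge0// => q /sK qK.
  by rewrite mulr_ge0// stilde_ge0//; have /andP[] := g_range qK.
set c := _ + C n in s0.
have mU : measurable_fun setT (U a).
  apply: measurable_sum => p; apply: measurable_funM => //.
  exact: (npoints_measurable birth (ball_measurable p)).
have U0 w : 0 <= U a w.
  by apply: sumr_ge0 => p _; rewrite mulr_ge0// mulr_ge0.
set Q := fun w => mark_mean K nu (enum_fset (Phi w))
      (fun ps => F (grow g s `|` admit_births K a ps)).
have Q0 w : (0 <= Q w)%E.
  suff /andP[] : (0 <= Q w <= Q w)%E by [].
  by apply: mark_mean_le => ps _ psK; rewrite lexx andbT; exact/F0/nextK.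
have := @campbell_ge _ _ _ P W K beta Phi birth c Rw (fun y => (h n y)%:E) (U a) Q
  beta_gt0 s0 Rw_gt0 _ Q0 mU U0 _.
rewrite (I_spec _).1 U_mean => campbell.
rewrite !addrA EFinB leeBlDr//; apply: le_trans (campbell _ _).
- by rewrite -EFinM -EFinD.
- by move=> y _; rewrite lee_fin; have [_ /andP[]] := h_spec n y.
move=> w hc; have [PhiW _ _ _] := birth.
(* The admissibility factor erases the scores of rejected births. *)
pose f (p : mpoint) := (admissible K a p.1)%:R * (Rw * stilde n p.1 p.2).
have meanE : mark_mean K nu (enum_fset (Phi w)) (fun ps => (c + \sum_(p <- ps) f p)%:E) =
    (c + \sum_(y <- Phi w) (admissible K a y)%:R * (Rw * h n y))%:E.
  rewrite mark_mean_sum//; last 2 first.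
  - by move=> y l /andP[l0 _]; rewrite /f /= mulr_ge0// mulr_ge0// stilde_ge0.
  - move=> y; rewrite /f /=; apply: measurable_funM => //; apply: measurable_funM => //.
    exact: stilde_measurable.
  rewrite [RHS]EFinD -sumEFin; congr (_ + _)%E; apply: eq_bigr => y _.
  rewrite /f /=; under eq_integral do rewrite mulrA EFinM.
  rewrite ge0_integralZl_EFin//.
  - by rewrite (h_spec n y).1 -EFinM mulrA.
  - by move=> l; rewrite /= in_itv/= lee_fin => /andP[l0 _]; exact: stilde_ge0.
  - by apply/measurable_EFinP; exact: stilde_measurable.
  - by rewrite mulr_ge0.
have : ((c + \sum_(y <- Phi w) (admissible K a y)%:R * (Rw * h n y))%:E <= Q w)%E.
  rewrite -meanE.
  suff /andP[] : (0 <= mark_mean K nu (enum_fset (Phi w))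
      (fun ps => (c + \sum_(p <- ps) f p)%:E) <= Q w)%E by [].
  apply: mark_mean_le => ps psE psK; rewrite lee_fin; apply/andP; split.
    rewrite addr_ge0// big_seq sumr_ge0// => p /psK /andP[p0 _].
    by rewrite mulr_ge0// mulr_ge0// stilde_ge0.
  have psPhi p : p \in ps -> p.1 \in Phi w 
    by move=> pps; have := map_f (fun q : mpoint => q.1) pps; rewrite psE.
  have ups : uniq [seq p.1 | p <- ps] by rewrite psE fset_uniq.
  apply: le_trans (FX _ _); last first.
    apply: next_state_space => //; first by move=> p /psPhi; exact: PhiW.
    by move=> p q /psPhi pP /psPhi qP; exact: hc.
  rewrite vtildeE lee_fin /c -addrA (addrC (C n)) addrA lerD2r mulr_sumr.
  apply: le_trans; last apply: (@sum_next_ge _ _ _ _ K_gt0 g_range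
    (fun p => Rw * stilde n p.1 p.2) _ _ _ aX sa ups _ psK).
    rewrite lerD2l [leRHS]big_mkcond /=; apply: ler_sum => p _.
    by rewrite /f; case: ifP; rewrite ?mul1r ?mul0r.
  by move=> p /andP[p0 _]; rewrite mulr_ge0 ?stilde_ge0.
move=> Q_ge; apply: le_trans (leeD2r (U a w)%:E Q_ge).
rewrite sumEFin -EFinM -!EFinD lee_fin -(addrA c) lerD2l mulr_sumr.
have -> : U a w = \sum_(y <- Phi w) \sum_(p <- a) Rw * K * \1_(cball p.1 K `&` W)%classic y.
  rewrite /U; under eq_bigr do rewrite npointsE mulr_sumr.
  exact: exchange_big.
rewrite -big_split /= big_seq [leRHS]big_seq; apply: ler_sum => y yw.
have [_ /andP[hy0 hyK]] := h_spec n y.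
have RwK : 0 <= Rw * K by rewrite mulr_ge0.
have ind0 p : 0 <= Rw * K * \1_(cball p.1 K `&` W)%classic y.
  by rewrite mulr_ge0.
case: (boolP (admissible K a y)) => [_|/allPn[q qa]].
  by rewrite mul1r lerDl sumr_ge0.
(* A rejected birth lies in the ball of some [q] in [a], and the charge for [q] alone covers its
   mean score, as [h n y <= K]. *)
rewrite negbK => qy; rewrite mul0r add0r (big_fsetD1 q)//= indicE mem_set.
  rewrite mulr1 -[leLHS]addr0 lerD ?sumr_ge0// ler_wpM2l//.
by split => //; exact: PhiW yw.
Qed.

Lemma vtilde_le_value n (x : {fset mpoint}) : state_space W K x ->
  (vtilde W K Rw pd beta alpha g nu n x <= value n x)%E.
Proof.
elim: n x => [|n IH] x xX; rewrite vtildeE.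
  rewrite /C big_geq// mulr0 addr0 big1 ?mulr0//.
pose a := [fset p in x | p.2 < stilde n.+1 p.1 p.2].
have ax : a `<=` x by apply/fsubsetP => p; rewrite !inE /= => /andP[].
have aX := state_space_sub xX ax.
have a_act : a \in actions W K x by rewrite mem_actions ax; exact/asboolP.
apply: le_trans (value_ge_action n a_act).
have next_ge : (((1 - pd) * (\sum_(q <- a) (Rw * stilde n q.1 (g q.2))) +
    (C n + Rw * beta * I n - Rw * \sum_(p <- a) loss p.1))%:E <=
    next_mean (value n) a)%E.
  apply: next_mean_ge => s sa; apply: le_next_vtilde => //; exact: value_ge0.
apply: le_trans (leeD2l _ (lee_wpmul2l _ next_ge)); last by rewrite lee_fin.
rewrite -EFinM -EFinD lee_fin CS /reward -mulr_sumr (big_fsetD_split _ ax).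
have xK p : p \in x -> 0 <= p.2 by move=> px; have [/(_ p px)[_ /andP[]]] := xX.
have keep : \sum_(p <- a) stilde n.+1 p.1 p.2 <=
    \sum_(p <- a) (alpha * (1 - pd) * stilde n p.1 (g p.2) - alpha * loss p.1).
  rewrite big_seq [leRHS]big_seq; apply: ler_sum => p.
  rewrite !inE /= => /andP[px p_lt].
  (* On [a] the score strictly exceeds the mark, so the maximum in the recursion is its second
     branch; off [a] the score is at most the mark, which is harvested. *)
  have := stilde_grow W K beta g pd_lt1 alpha_ge0 n p.1 (xK p px).
  by rewrite le_max leNgt p_lt.
have harvest : \sum_(p <- x `\` a) stilde n.+1 p.1 p.2 <= \sum_(p <- x `\` a) p.2.
  rewrite big_seq [leRHS]big_seq; apply: ler_sum => p.
  by rewrite !inE /= => /andP[pa px]; move: pa; rewrite px /= -leNgt.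
rewrite sumrB -2!mulr_sumr in keep.
set S1 := \sum_(p <- x `\` a) stilde n.+1 _ _ in harvest *.
set S2 := \sum_(p <- a) stilde n.+1 _ _ in keep *.
set S3 := \sum_(p <- _) p.2 in harvest *.
set S4 := \sum_(p <- _) stilde n _ _ in keep *.
set S5 := \sum_(p <- _) loss _ in keep *.
have := ler_wpM2l Rw_ge0 (lerD harvest keep); lra.
Qed.

End lower.

End bounds.

Unset Implicit Arguments.
Set Strict Implicit.
Set Printing Implicit Defensive.

Theorem theorem2 (R : realType) (d : measure_display) (Omega : measurableType d)
    (P : probability Omega R) (W : set (R * R)) (K Rw pd beta alpha : R)
    (g : R -> R) (nu : probability (measurableTypeR R) R)
    (Phi : Omega -> {fset R * R})
    (compW : compact W) (K_gt0 : 0 < K) (Rw_gt0 : 0 < Rw)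
    (pd_gt0 : 0 < pd) (pd_lt1 : pd < 1) (beta_gt0 : 0 < beta)
    (alpha_ge0 : 0 <= alpha) (alpha_lt1 : alpha < 1)
    (g_range : forall m, 0 <= m <= K -> 0 <= g m <= K)
    (g_cont : {within `[0, K], continuous g})
    (g_ge : forall m, 0 <= m <= K -> m <= g m)
    (nu_supp : nu `[0, K]%classic = 1%E)
    (birth : hard_core_process W K beta P Phi)
    (n : nat) (x : {fset (R * R) * R}) (xX : state_space W K x) :
  (vtilde W K Rw pd beta alpha g nu n x
     <= value P W K Rw pd alpha g nu Phi n x)%E /\
  (value P W K Rw pd alpha g nu Phi n x
     <= vhat W K Rw pd beta alpha g nu n x)%E.
Proof.
split; first exact: vtilde_le_value.
by apply: value_le_vhat => // p px; have [/(_ p px)[]] := xX.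
Qed.
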